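(* For every odd positive integer $k$, there exists a tight polyhedron of type $\{3k,4\}$ which is regular but not orientably-regular, and whose automorphism group is isomorphic to $$\Lambda(k)=\langle \rho_0,\rho_1,\rho_2 \mid \rho_0^2,\ \rho_1^2,\ \rho_2^2,\ (\rho_0\rho_1)^{3k},\ (\rho_0\rho_2)^2,\ (\rho_1\rho_2)^4,\ \rho_0\rho_1\rho_2\rho_1\rho_0\rho_1\rho_2\rho_1\rho_2\rangle.$$
   Context: A polyhedron is an abstract polytope of rank $3$ (a ranked poset with ranks $-1$ to $3$, unique least and greatest faces, flags of $5$ faces, connected sections, and the diamond condition). It has type $\{p,q\}$ if every $2$-face is a $p$-gon and every vertex-figure a $q$-gon; it is tight if it has exactly $2pq$ flags. It is regular if its automorphism group acts transitively on flags, in which case the group is generated by the reflections $\rho_0,\rho_1,\rho_2$ with respect to a base flag; a regular polyhedron is orientably-regular if the rotation subgroup $\langle\rho_0\rho_1,\rho_1\rho_2\rangle$ has index $2$ in the automorphism group, and non-orientably-regular if this subgroup is the whole automorphism group. *)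

(* Defs.v *)
From HB Require Import structures.
From mathcomp Require Import all_boot all_order all_algebra all_fingroup.
From mathcomp Require Import boolp.

Set Implicit Arguments.
Unset Strict Implicit.
Unset Printing Implicit Defensive.

Import Order.TTheory GRing.Theory Num.Theory.

Local Open Scope ring_scope.
Local Open Scope quotient_scope.

Section Poset.
Context {d : Order.disp_t} {P : finPOrderType d}.
Implicit Types (x y F G : P) (C : {set P}).

Definition chain C := [forall x in C, forall y in C, (x >=< y)%O].

Definition flags : {set {set P}} := [set C | maxset chain C].

(* The proper faces of the section G/F. *)
Definition open_section F G : {set P} := [set x | (F < x < G)%O].

Definition incident_in F G : rel P :=
  fun x y => [&& x \in open_section F G, y \in open_section F G & (x >=< y)%O].

Definition section_connected F G :=
  {in open_section F G &, forall x y, connect (incident_in F G) x y}.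

Definition Aut_poset : {set {perm P}} :=
  [set s : {perm P} | [forall x, forall y, (s x <= s y)%O == (x <= y)%O]].

Lemma Aut_poset_group_set : group_set Aut_poset.
Proof.
apply/group_setP; split=> [|s t].
  by rewrite inE; do 2 apply/forallP=> ?; rewrite !perm1.
rewrite !inE => /forallP sP /forallP tP; do 2 apply/forallP=> ?.
by rewrite !permM (eqP (forallP (tP _) _)) (eqP (forallP (sP _) _)).
Qed.

Canonical Aut_poset_group := Group Aut_poset_group_set.

End Poset.

Arguments flags {d} P.
Arguments Aut_poset {d} P.
Arguments Aut_poset_group {d} P.

(* Finiteness is no loss here: a tight polyhedron has finitely many flags, and
   every face lies in a flag.  The section G/F has rank
   rank G - rank F - 1; sections of rank at most 1 count as connected. *)
Record polytope (n : nat) := Polytope {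
  disp : Order.disp_t;
  face :> finTBPOrderType disp;
  rank : face -> int;
  rank_bot : rank \bot%O = -1;
  rank_top : rank \top%O = n%:Z;
  rank_lt : {homo rank : x y / (x < y)%O >-> x < y};
  card_flag : forall C, C \in flags face -> #|C| = (n + 2)%N;
  strongly_connected : forall F G : face, (F < G)%O ->
    2 <= rank G - rank F - 1 -> section_connected F G;
  diamond : forall F G : face, (F < G)%O -> rank G = rank F + 2 ->
    #|open_section F G| = 2%N
}.

Notation polyhedron := (polytope 3).

Section Polytope.
Context {n : nat}.
Implicit Type P : polytope n.

(* The section G/F is the face lattice of a p-gon: its vertices v and edges e
   are arranged in a cycle, e_j joining v_j and v_(j + 1 mod p). *)
Definition is_polygon P (p : nat) (F G : P) :=
  rank G = rank F + 3 /\
  exists v e : 'I_p -> P,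
    [/\ injective v, injective e,
        forall x, (x \in codom v) =
                  (x \in open_section F G) && (rank x == rank F + 1),
        forall x, (x \in codom e) =
                  (x \in open_section F G) && (rank x == rank F + 2) &
        forall i j, (v i <= e j)%O = (i == j) || (i == ordS j)].

Definition regular P := [transitive Aut_poset P, on flags P | 'P^*].

Definition adjacent_flags P (i : int) (C D : {set P}) :=
  (C != D) && ([set x in C | rank x != i] == [set x in D | rank x != i]).

(* s is the reflection rho_i with respect to the base flag C. *)
Definition is_reflection P (C : {set P}) (i : int) (s : {perm P}) :=
  s \in Aut_poset P /\ adjacent_flags i C (s @: C).

End Polytope.

Definition has_type (P : polyhedron) (p q : nat) :=
  (forall F : P, rank F = 2 -> is_polygon p \bot%O F) /\
  (forall v : P, rank v = 0 -> is_polygon q v \top%O).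

Definition tight (P : polyhedron) (p q : nat) :=
  has_type P p q /\ #|flags P| = (2 * p * q)%N.

Definition orientably_regular (P : polyhedron) :=
  regular P /\
  exists (C : {set P}) (r0 r1 r2 : {perm P}),
    [/\ C \in flags P, is_reflection C 0 r0, is_reflection C 1 r1,
        is_reflection C 2 r2 &
        #|Aut_poset P : <<[set r0 * r1; r1 * r2]>>|%g = 2%N].

Section Presentation.
Variable X : choiceType.

(* The letter (x, b) stands for x if b is false and for x^-1 if b is true. *)
Definition word := seq (X * bool).

Variable R : seq word.

Implicit Types u v w : word.

Definition inv_letter (a : X * bool) := (a.1, ~~ a.2).

Definition inv_word w : word := rev (map inv_letter w).

Inductive presents_eq : word -> word -> Prop :=
| presents_refl u : presents_eq u u
| presents_sym u v : presents_eq u v -> presents_eq v u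
| presents_trans u v w :
    presents_eq u v -> presents_eq v w -> presents_eq u w
| presents_cancel u a v : presents_eq (u ++ [:: a; inv_letter a] ++ v) (u ++ v)
| presents_relator u r v : r \in R -> presents_eq (u ++ r ++ v) (u ++ v).

Definition presents_eqb : rel word := fun u v => `[< presents_eq u v >].

Lemma presents_eqb_refl : reflexive presents_eqb.
Proof. by move=> u; apply/asboolP; apply: presents_refl. Qed.

Lemma presents_eqb_sym : symmetric presents_eqb.
Proof. by move=> u v; apply/asboolP/asboolP => /presents_sym. Qed.

Lemma presents_eqb_trans : transitive presents_eqb.
Proof.
move=> v u w /asboolP uv /asboolP vw; apply/asboolP.
exact: presents_trans uv vw.
Qed.

Canonical presents_equiv :=
  EquivRel presents_eqb presents_eqb_refl presents_eqb_sym presents_eqb_trans.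

(* The group <X | R>. *)
Definition presented := {eq_quot presents_eqb}.

HB.instance Definition _ := EqQuotient.on presented.
HB.instance Definition _ := Choice.on presented.

Definition word_class w : presented := \pi_presented w.

Lemma word_classP u v : word_class u = word_class v <-> presents_eq u v.
Proof.
by split=> [/eqmodP/asboolP // | uv]; apply/eqmodP/asboolP.
Qed.

Lemma word_classK (x : presented) : word_class (generic_quotient.repr x) = x.
Proof. exact: reprK. Qed.

Lemma inv_letterK : involutive inv_letter.
Proof. by case=> x b; rewrite /inv_letter negbK. Qed.

Lemma inv_wordK : involutive inv_word.
Proof. by move=> w; rewrite /inv_word map_rev revK mapK //; exact: inv_letterK. Qed.

Lemma presents_catl w u v : presents_eq u v -> presents_eq (w ++ u) (w ++ v).
Proof.
elim=> [z|y z _|x y z _ xy _ yz|x a z|x r z rR].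
- exact: presents_refl.
- exact: presents_sym.
- exact: presents_trans xy yz.
- by rewrite !(catA w); apply: presents_cancel.
- by rewrite !(catA w); apply: presents_relator.
Qed.

Lemma presents_catr w u v : presents_eq u v -> presents_eq (u ++ w) (v ++ w).
Proof.
elim=> [z|y z _|x y z _ xy _ yz|x a z|x r z rR].
- exact: presents_refl.
- exact: presents_sym.
- exact: presents_trans xy yz.
- by rewrite -!catA; apply: presents_cancel.
- by rewrite -!catA; apply: presents_relator.
Qed.

Lemma presents_cat u u' v v' :
  presents_eq u u' -> presents_eq v v' -> presents_eq (u ++ v) (u' ++ v').
Proof.
move=> uu' vv'; apply: presents_trans (presents_catr v uu') _.
exact: presents_catl.
Qed.

Lemma presents_mulV w : presents_eq (w ++ inv_word w) [::].
Proof.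
elim: w => [|a w IHw]; first exact: presents_refl.
rewrite /inv_word map_cons rev_cons -cats1.
have := presents_catl [:: a] (presents_catr [:: inv_letter a] IHw).
rewrite -catA => /presents_trans; apply.
exact: (presents_cancel [::] a [::]).
Qed.

Lemma presents_mulVl w : presents_eq (inv_word w ++ w) [::].
Proof. by have := presents_mulV (inv_word w); rewrite inv_wordK. Qed.

Lemma presents_inv u v : presents_eq u v -> presents_eq (inv_word u) (inv_word v).
Proof.
move=> uv.
apply: (@presents_trans _ (inv_word u ++ (v ++ inv_word v))).
  rewrite -[X in presents_eq X _]cats0.
  exact/presents_catl/presents_sym/presents_mulV.
rewrite catA -[X in presents_eq _ X]cat0s; apply: presents_catr.
apply: presents_trans (presents_catl _ (presents_sym uv)) _.
exact: presents_mulVl.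
Qed.

Definition pres_one : presented := word_class [::].

Definition pres_inv (x : presented) : presented :=
  word_class (inv_word (generic_quotient.repr x)).

Definition pres_mul (x y : presented) : presented :=
  word_class (generic_quotient.repr x ++ generic_quotient.repr y).

Lemma presents_repr u : presents_eq (generic_quotient.repr (word_class u)) u.
Proof. by apply/word_classP; rewrite word_classK. Qed.

Lemma word_class_mul u v :
  pres_mul (word_class u) (word_class v) = word_class (u ++ v).
Proof. by apply/word_classP/presents_cat; apply: presents_repr. Qed.

Lemma word_class_inv u : pres_inv (word_class u) = word_class (inv_word u).
Proof. by apply/word_classP/presents_inv/presents_repr. Qed.

Lemma pres_mulA : associative pres_mul.
Proof.
move=> x y z; rewrite -(word_classK x) -(word_classK y) -(word_classK z).
by rewrite !word_class_mul catA.
Qed.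

Lemma pres_mul1g : left_id pres_one pres_mul.
Proof. by move=> x; rewrite -(word_classK x) word_class_mul. Qed.

Lemma pres_mulg1 : right_id pres_one pres_mul.
Proof. by move=> x; rewrite -(word_classK x) word_class_mul cats0. Qed.

Lemma pres_mulVg : left_inverse pres_one pres_inv pres_mul.
Proof.
move=> x; rewrite -(word_classK x) word_class_inv word_class_mul.
exact/word_classP/presents_mulVl.
Qed.

Lemma pres_mulgV : right_inverse pres_one pres_inv pres_mul.
Proof.
move=> x; rewrite -(word_classK x) word_class_inv word_class_mul.
exact/word_classP/presents_mulV.
Qed.

HB.instance Definition _ := isGroup.Build presented
  pres_mulA pres_mul1g pres_mulg1 pres_mulVg pres_mulgV.

End Presentation.

Definition word_exp (X : choiceType) (w : word X) (m : nat) : word X :=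
  flatten (nseq m w).

Definition Lambda_relators (k : nat) : seq (word 'I_3) :=
  let r0 := (Ordinal (isT : 0 < 3)%N, false) in
  let r1 := (Ordinal (isT : 1 < 3)%N, false) in
  let r2 := (Ordinal (isT : 2 < 3)%N, false) in
  [:: word_exp [:: r0] 2; word_exp [:: r1] 2; word_exp [:: r2] 2;
      word_exp [:: r0; r1] (3 * k); word_exp [:: r0; r2] 2;
      word_exp [:: r1; r2] 4;
      [:: r0; r1; r2; r1; r0; r1; r2; r1; r2]].

Definition Lambda (k : nat) : groupType := presented (Lambda_relators k).

Definition isomorphic (G H : groupType) :=
  exists f : {multiplicative G -> H}, bijective f.

(* Main.v *)
(* Put n = 3k.  Take as vertices Z/n, as facets the four points of F_2^2, and
   as edges two edges (j, s), s in F_2, joining j to j + 1.  Every vertex lies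
   on every facet, and (j, s) lies on f iff lam_c f = s, where lam_0, lam_1,
   lam_2 are the three nonzero linear forms on F_2^2 and c = j mod 3.

   An automorphism commutes with the passage from a flag to an adjacent one,
   and any two flags are linked by such passages, so the automorphisms act
   freely on flags; three explicit ones taking the base flag to its neighbours
   then generate the group and make it transitive.

   In Lambda(k) the relator of odd length says that r2, its conjugate by r1 and
   the conjugate of that by r0 multiply to 1, so they form a Klein four-group,
   normalised by the dihedral group of r0 and r1.  This gives a normal form
   r1^b (r1 r0)^i v with b < 2, i < n and v in the four-group, hence one class
   per flag, and left multiplication by r_i is the passage to the i-adjacent
   flag.  The odd relator also expresses r2 as a product of rotations. *)

From HB Require Import structures.
Require Import Defs.
From mathcomp Require Import all_boot all_order all_algebra all_fingroup.
From mathcomp Require Import zify.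

Set Implicit Arguments.
Unset Strict Implicit.
Unset Printing Implicit Defensive.

Import Order.TTheory GRing.Theory Num.Theory.

Local Open Scope ring_scope.

(** * The three nonzero linear forms on the plane over F_2 *)

Definition lam (c : 'I_3) (f : bool * bool) : bool :=
  match val c with 0 => f.1 | 1 => f.2 | _ => f.1 (+) f.2 end.

(* The nonzero vector in the kernel of [lam c]. *)
Definition dir (c : 'I_3) : bool * bool :=
  match val c with 0 => (false, true) | 1 => (true, false) | _ => (true, true) end.

Definition shift (w f : bool * bool) : bool * bool := (w.1 (+) f.1, w.2 (+) f.2).

Lemma I3P (Q : 'I_3 -> Prop) : Q 0 -> Q 1 -> Q (1 + 1) -> forall c, Q c.
Proof.
move=> Q0 Q1 Q2 [[|[|[|//]]] i]; [move: Q0|move: Q1|move: Q2];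
  by congr Q; apply: val_inj.
Qed.

(* The linear map permuting the forms [lam] by [c |-> a - 1 - c], as forced by the
   reflection [j |-> a - 1 - j] of the edges. *)
Definition mirror (a : 'I_3) (f : bool * bool) : bool * bool :=
  (lam (a - 1) f, lam (a - 1 - 1) f).

(** The three forms add up to zero, so each permutation of them is induced by a linear map of the
    plane. *)
Lemma lam_mirror (a c : 'I_3) f : lam (a - 1 - c) (mirror a f) = lam c f.
Proof. by case: f => [[] []]; move: a c; do 2 apply: I3P. Qed.

Lemma mirrorK a : involutive (mirror a).
Proof. by case=> [[] []]; move: a; apply: I3P. Qed.

Lemma lam_shift c w f : lam c (shift w f) = lam c w (+) lam c f.
Proof. by case: f w => [[] []] [[] []]; move: c; apply: I3P. Qed.

Lemma shiftK w : involutive (shift w).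
Proof. by case: w => [[] []] [[] []]. Qed.

Lemma lam_dir c : lam c (dir c) = false.
Proof. by move: c; apply: I3P. Qed.

(** The kernel of a nonzero form is a line, spanned by [dir c], so its fibres have two points. These
    fibres become the pairs of facets on an edge. *)
Lemma lam_eqP c f g : lam c f = lam c g -> f = g \/ f = shift (dir c) g.
Proof.
by case: f g => [[] []] [[] []]; move: c; apply: I3P => //= _; (by left) || (by right).
Qed.

Lemma shift_dir_neq c f : (f == shift (dir c) f) = false.
Proof. by case: f => [[] []]; move: c; apply: I3P. Qed.

(* The point where [lam c] is [s] and [lam (c - 1)] is [t]. *)
Definition solve (c : 'I_3) (s t : bool) : bool * bool :=
  match val c with 0 => (s, s (+) t) | 1 => (t, s) | _ => (s (+) t, t) end.

Lemma lam_solve c s t : lam c (solve c s t) = s /\ lam (c - 1) (solve c s t) = t.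
Proof. by case: s t => [] []; move: c; apply: I3P. Qed.

Lemma solveK c f : solve c (lam c f) (lam (c - 1) f) = f.
Proof. by case: f => [[] []]; move: c; apply: I3P. Qed.

(** One walks round the cycle of vertices and edges. The poset and its rank function are bare
    because connectedness is needed to build a [polytope], before [is_polygon] makes sense. *)
Lemma polygon_section_connected d (T : finPOrderType d) (r : T -> int) p (F G : T) :
    {homo r : x y / (x < y)%O >-> x < y} -> r G = r F + 3 ->
    (exists v e : 'I_p -> T,
    [/\ injective v, injective e,
        forall x, (x \in codom v) = (x \in open_section F G) && (r x == r F + 1),
        forall x, (x \in codom e) = (x \in open_section F G) && (r x == r F + 2) &
        forall i j, (v i <= e j)%O = (i == j) || (i == ordS j)]) ->
  section_connected F G.
Proof.
move=> r_lt rG [v [e [_ _ vP eP veP]]].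
have v_open i : v i \in open_section F G.
  by have := codom_f v i; rewrite vP => /andP[].
have e_open i : e i \in open_section F G.
  by have := codom_f e i; rewrite eP => /andP[].
have ve i j : (i == j) || (i == ordS j) -> connect (incident_in F G) (v i) (e j).
  by rewrite -veP => le_ve; apply: connect1; rewrite /incident_in v_open e_open /Order.comparable le_ve.
have conn_sym : connect_sym (incident_in F G).
  by apply: sym_connect_sym => x y; rewrite /incident_in comparable_sym andbCA.
have vS i : connect (incident_in F G) (v i) (v (ordS i)).
  apply: (connect_trans (ve i i _)); first by rewrite eqxx.
  by rewrite conn_sym ve ?eqxx ?orbT.
(* Descending one index at a time joins every vertex to the one of index 0. *)
have v0 (i j : 'I_p) : val j = 0%N -> connect (incident_in F G) (v i) (v j).
  move=> j0; case: i => i; elim: i => [|i IHi] lt_ip.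
    by rewrite (_ : Ordinal _ = j) //; apply: val_inj.
  rewrite conn_sym; have := IHi (ltnW lt_ip); rewrite conn_sym => /connect_trans; apply.
  have := vS (Ordinal (ltnW lt_ip)); congr (connect _ _ (v _)).
  by apply: val_inj; rewrite /= modn_small.
have to_v x : x \in open_section F G -> exists i, connect (incident_in F G) x (v i).
  move=> x_open; have /andP[Fx xG] : (F < x < G)%O by move: x_open; rewrite inE.
  have: (x \in codom v) || (x \in codom e).
    by rewrite vP eP x_open; move: (r_lt _ _ Fx) (r_lt _ _ xG); lia.
  by case/orP=> /codomP[i ->]; exists i; rewrite // conn_sym ve ?eqxx.
move=> x y /to_v[i xi] /to_v[j yj].
have p_gt0 : (0 < p)%N by apply: leq_ltn_trans (ltn_ord i).
apply: (connect_trans xi); rewrite conn_sym; apply: (connect_trans yj).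
rewrite conn_sym; apply: (connect_trans (v0 i (Ordinal p_gt0) _)) => //.
by rewrite conn_sym v0.
Qed.

(** * The polyhedron *)

Section Cell.
Context (m : nat).
Local Notation Zn := 'I_m.+3.

(** The modulus is written [m.+3] so that the vertices form the ring Z/n with 1 distinct from 0. *)
Inductive cell := Bot | Vert of Zn | Edge of Zn & bool | Facet of bool * bool | Top.

Local Notation code :=
  (unit + (Zn + (Zn * bool + (bool * bool + unit))))%type.

Definition cell_code (x : cell) : code :=
  match x with
  | Bot => inl tt
  | Vert i => inr (inl i)
  | Edge j s => inr (inr (inl (j, s)))
  | Facet f => inr (inr (inr (inl f)))
  | Top => inr (inr (inr (inr tt)))
  end.

Definition cell_decode (c : code) : cell :=
  match c with
  | inl _ => Bot
  | inr (inl i) => Vert i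
  | inr (inr (inl (j, s))) => Edge j s
  | inr (inr (inr (inl f))) => Facet f
  | inr (inr (inr (inr _))) => Top
  end.

Lemma cell_codeK : cancel cell_code cell_decode.
Proof. by case. Qed.

HB.instance Definition _ := Finite.copy cell (can_type cell_codeK).

Definition residue (i : Zn) : 'I_3 := inZp i.

Definition cell_rank (x : cell) : nat :=
  match x with Bot => 0 | Vert _ => 1 | Edge _ _ => 2 | Facet _ => 3 | Top => 4 end.

(** In the last case faces of different ranks are incident unconditionally; this puts every vertex
    on every facet. *)
Definition cell_le (x y : cell) : bool :=
  match x, y with
  | Vert i, Edge j _ => (i == j) || (i == j + 1)
  | Edge j s, Facet f => lam (residue j) f == s
  | _, _ => (cell_rank x < cell_rank y)%N || (x == y)
  end.

Lemma cell_le_refl : reflexive cell_le.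
Proof. by case=> *; rewrite /= ?eqxx. Qed.

Lemma cell_le_rank x y : cell_le x y -> (x == y) || (cell_rank x < cell_rank y)%N.
Proof. by case: x y => [|i|j s|f|] [|i'|j' s'|f'|] //=; rewrite ?ltnn ?orbF ?orbT. Qed.

Lemma cell_le_anti : antisymmetric cell_le.
Proof.
move=> x y /andP[/cell_le_rank /orP[/eqP // | xy] /cell_le_rank /orP[/eqP // | yx]].
by move: (ltn_trans xy yx); rewrite ltnn.
Qed.

(** Only consecutive ranks carry an incidence condition, and two strict steps raise the rank by at
    least 2. *)
Lemma cell_le_trans : transitive cell_le.
Proof.
move=> y x z xy yz.
have /orP[/eqP -> // | rxy] := cell_le_rank xy.
have /orP[/eqP yE | ryz] := cell_le_rank yz; first by rewrite -yE.
by case: x y z xy yz rxy ryz => [|?|? ?|?|] [|?|? ?|?|] [|?|? ?|?|].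
Qed.

Lemma Vert_eq i j : (Vert i == Vert j) = (i == j).
Proof. by apply/eqP/eqP=> [[]|->]. Qed.

Lemma Edge_eq i s j t : (Edge i s == Edge j t) = (i == j) && (s == t).
Proof. by apply/eqP/andP=> [[-> ->] | [/eqP-> /eqP->]]. Qed.

Lemma Facet_eq f g : (Facet f == Facet g) = (f == g).
Proof. by apply/eqP/eqP=> [[]|->]. Qed.

Definition cell_eqE := (Vert_eq, Edge_eq, Facet_eq).

Fact cell_display : Order.disp_t. Proof. exact: (Order.Disp tt tt). Qed.

HB.instance Definition _ := Order.Le_isPOrder.Build cell_display cell
  cell_le_refl cell_le_anti cell_le_trans.

Lemma cell_bot (x : cell) : (Bot <= x)%O.
Proof. by case: x. Qed.
Lemma cell_top (x : cell) : (x <= Top)%O.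
Proof. by case: x. Qed.

HB.instance Definition _ := Order.hasBottom.Build cell_display cell cell_bot.
HB.instance Definition _ := Order.hasTop.Build cell_display cell cell_top.


Lemma cell_ltE (x y : cell) :
  (x < y)%O = cell_le x y && (cell_rank x < cell_rank y)%N.
Proof.
rewrite lt_neqAle /Order.le /=; apply/andP/andP => [[xy le_xy] | [le_xy rxy]].
  by have := cell_le_rank le_xy; rewrite (negPf xy).
by split=> //; apply: contraTneq rxy => ->; rewrite ltnn.
Qed.

Definition cell_height (x : cell) : int := (cell_rank x)%:Z - 1.

Lemma cell_height_lt : {homo cell_height : x y / (x < y)%O >-> x < y}.
Proof. by move=> x y; rewrite cell_ltE /cell_height => /andP[_]; lia. Qed.

Lemma cell_height1 x y :
  (cell_height x == cell_height y + 1) = (cell_rank x == cell_rank y + 1)%N.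
Proof. by rewrite /cell_height; lia. Qed.

Lemma cell_height2 x y :
  (cell_height x == cell_height y + 2) = (cell_rank x == cell_rank y + 2)%N.
Proof. by rewrite /cell_height; lia. Qed.

Lemma succ_neq (i : Zn) : (i + 1 == i) = false.
Proof. by rewrite -[X in _ == X]addr0 (inj_eq (addrI i)); apply/eqP=> /(congr1 val). Qed.

Lemma pred_neq (i : Zn) : (i - 1 == i) = false.
Proof. by rewrite -(succ_neq (i - 1)) subrK eq_sym. Qed.

(** * The diamond condition, polygonal sections and connectedness *)

Context (m3 : (3 %| m.+3)%N).

(** Reduction from Z/n to Z/3 is additive because 3 divides n; the assignment of forms to edges thus
    closes up around the cycle. *)
Lemma residueD i j : residue (i + j) = residue i + residue j.
Proof. by apply: val_inj; rewrite /= modn_dvdm // modnDm. Qed.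

Lemma residue1 : residue 1 = 1.
Proof. by apply: val_inj; rewrite /= modn_small. Qed.

Lemma residueB i j : residue (i - j) = residue i - residue j.
Proof. by apply: (addIr (residue j)); rewrite -residueD !subrK. Qed.

(** An edge has two ends; on a given facet each of the two places next to a vertex carries exactly
    one edge; and the facets on an edge are the two points of a fibre of its form. *)
Lemma cell_diamond (F G : cell) : (F < G)%O -> cell_height G = cell_height F + 2 ->
  #|open_section F G| = 2%N.
Proof.
have card_pair x y : x != y -> open_section F G = [set x; y] -> #|open_section F G| = 2%N.
  by move=> xy ->; rewrite cards2 xy.
move: card_pair; rewrite cell_ltE /cell_height.
case: F G => [|i|j s|f|] [|i'|j' s'|f'|] //= card_pair FG hFG; try by lia.
- apply: (card_pair (Vert (j' + 1)) (Vert j')); first by rewrite cell_eqE succ_neq.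
  apply/setP=> x; rewrite !inE !cell_ltE; case: x => [|?|? ?|?|] //=.
    by rewrite !cell_eqE andbT orbC.
  by rewrite andbF.
- apply: (card_pair (Edge (i - 1) (lam (residue (i - 1)) f')) (Edge i (lam (residue i) f'))).
    by rewrite cell_eqE pred_neq.
  apply/setP=> x; rewrite !inE !cell_ltE; case: x => [|?|j s|?|] //=.
    by rewrite andbF.
  have -> : (i == j + 1) = (j == i - 1) by rewrite [RHS]eq_sym subr_eq.
  rewrite !cell_eqE !andbT andb_orl orbC (eq_sym i) !(eq_sym s).
    by congr (_ || _); case: eqP => [->|].
  by rewrite andbF.
- have [lam0 _] := lam_solve (residue j) s false; have [lam1 _] := lam_solve (residue j) s true.
  apply: (card_pair (Facet (solve (residue j) s false)) (Facet (solve (residue j) s true))).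
    rewrite cell_eqE; apply/eqP=> /(congr1 (lam (residue j - 1))).
    by rewrite !(lam_solve _ _ _).2.
  apply/setP=> x; rewrite !inE !cell_ltE; case: x => [|?|? ?|f|] //=.
    by rewrite andbF.
  rewrite !cell_eqE !andbT; apply/eqP/orP=> [<-|].
    case lf: (lam (residue j - 1) f); [right|left]; apply/eqP; by rewrite -lf solveK.
  by case=> /eqP->.
Qed.




(** At each place a facet selects one of the two parallel edges, the one labelled by the value of
    the form, so what lies below it is a single n-cycle. *)
Lemma facet_polygon (f : bool * bool) :
  exists v e : 'I_m.+3 -> cell,
    [/\ injective v, injective e,
        forall x, (x \in codom v) = (x \in open_section Bot (Facet f)) &&
          (cell_height x == cell_height Bot + 1),
        forall x, (x \in codom e) = (x \in open_section Bot (Facet f)) &&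
          (cell_height x == cell_height Bot + 2) &
        forall i j, (v i <= e j)%O = (i == j) || (i == ordS j)].
Proof.
exists Vert, (fun j => Edge j (lam (residue j) f)); split.
- by move=> i j [].
- by move=> i j [].
- move=> x; rewrite inE !cell_ltE ?cell_height1 ?cell_height2.
  case: x => [|i|j s|g|] /=; rewrite ?andbF //.
  2: by rewrite codom_f.
  1-4: by apply/negbTE/codomP=> -[].
- move=> x; rewrite inE !cell_ltE ?cell_height1 ?cell_height2; case: x => [|i|j s|g|] /=; rewrite ?andbF ?andbT //.
  1,2,4,5: by apply/negbTE/codomP=> -[].
  by apply/codomP/eqP=> [[_ [-> ->]] | <-] //; exists j.
- move=> i j; rewrite /Order.le /=; congr (_ || (i == _)).
  by apply: val_inj; rewrite /= (modn_small (isT : (1 < m.+3)%N)) addn1.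
Qed.

(** Consecutive forms are independent, so [lam c] and [lam (c - 1)] are coordinates in which the
    four facets are the corners of a square and the four edges at the vertex are its sides. *)
Lemma vertex_polygon (i : Zn) :
  exists v e : 'I_4 -> cell,
    [/\ injective v, injective e,
        forall x, (x \in codom v) = (x \in open_section (Vert i) Top) &&
          (cell_height x == cell_height (Vert i) + 1),
        forall x, (x \in codom e) = (x \in open_section (Vert i) Top) &&
          (cell_height x == cell_height (Vert i) + 2) &
        forall i j, (v i <= e j)%O = (i == j) || (i == ordS j)].
Proof.
pose c := residue i.
(* The edges alternate between the places [i] and [i - 1]. The facets follow a Gray code, changing
   one coordinate at a time, and the coordinate kept from one facet to the next names their common
   edge. *)
pose v (a : 'I_4) := Edge (if odd a then i - 1 else i) (1 < a)%N.
pose e (a : 'I_4) := Facet (solve c ((0 < a) && (a < 3))%N (1 < a)%N).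
exists v, e.
have e_inj : injective e.
  move=> a b [ab]; have := congr1 (lam (residue i)) ab; have := congr1 (lam (residue i - 1)) ab.
  rewrite !(lam_solve _ _ _).1 !(lam_solve _ _ _).2; move: a b {ab}.
  by do 2 case=> [[|[|[|[|//]]]] ?]; rewrite //= => _ _; apply: val_inj.
have v_inj : injective v.
  have := pred_neq i; rewrite eq_sym => i1 a b [].
  case: a b => [[|[|[|[|//]]]] ?] [[|[|[|[|//]]]] ?]; rewrite //= => /eqP; rewrite ?i1 ?pred_neq // => _ _; exact: val_inj.
split=> //.
- move=> x; rewrite inE !cell_ltE ?cell_height1 ?cell_height2; case: x => [|j|j s|g|] /=; rewrite ?andbF ?andbT //.
  1,2,4,5: by apply/negbTE/codomP=> -[].
  have -> : (i == j + 1) = (j == i - 1) by rewrite [RHS]eq_sym subr_eq.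
  rewrite (eq_sym i).
  apply/codomP/orP=> [[a [-> _]]|].
    by case: odd; [right|left].
  case=> /eqP->; case: s; [exists (inord 2) | exists (inord 0) | exists (inord 3) | exists (inord 1)];
    by rewrite /v inordK.
- move=> x; rewrite inE !cell_ltE ?cell_height1 ?cell_height2; case: x => [|j|j s|g|] /=; rewrite ?andbF ?andbT //.
  1,2,3,5: by apply/negbTE/codomP=> -[].
  apply/codomP; rewrite -(solveK c g).
  case: (lam c g) (lam (c - 1) g) => [] [];
    [exists (inord 2) | exists (inord 1) | exists (inord 3) | exists (inord 0)];
    by rewrite /e inordK.
- move=> a b; rewrite /Order.le /=.
  by case: a b => [[|[|[|[|//]]]] ?] [[|[|[|[|//]]]] ?];
   rewrite /= ?residueB ?residue1 ?(lam_solve _ _ _).1 ?(lam_solve _ _ _).2.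
Qed.

(** The sections of rank at least 2 are the polygons and the whole poset; in the latter, all
    vertices and facets are mutually incident and each edge has an end. *)
Lemma cell_connected (F G : cell) : (F < G)%O ->
  2 <= cell_height G - cell_height F - 1 -> section_connected F G.
Proof.
have conn_sym x y : connect_sym (incident_in x y).
  by apply: sym_connect_sym => u v; rewrite /incident_in comparable_sym andbCA.
rewrite cell_ltE /cell_height.
case: F G => [|i|j s|f|] [|i'|j' s'|f'|] //= FG hFG; try by lia.
- exact: polygon_section_connected cell_height_lt _ (facet_polygon f').
- pose R := incident_in Bot Top.
  have link x y : (0 < cell_rank x < 4)%N -> (0 < cell_rank y < 4)%N -> cell_le x y -> connect R x y.
    move=> xP yP xy; apply: connect1; rewrite /R /incident_in /Order.comparable [(x <= y)%O]xy.
    by rewrite !inE !cell_ltE; case: x y xP yP {xy} => [|?|? ?|?|] [|?|? ?|?|].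
  have to_facet f : connect R (Vert 0) (Facet f) by exact: link.
  have to_vert i : connect R (Vert 0) (Vert i).
    by apply: connect_trans (to_facet (false, false)) _; rewrite conn_sym link.
  have to_cell x : x \in open_section Bot Top -> connect R (Vert 0) x.
    rewrite inE !cell_ltE; case: x => [|i|j s|f|] //= _.
    by apply: connect_trans (to_vert j) _; rewrite link //= eqxx.
  move=> x y /to_cell x0 /to_cell; apply: connect_trans.
  by rewrite conn_sym.
- exact: polygon_section_connected cell_height_lt _ (vertex_polygon i).
Qed.


(** * Flags encoded as triples *)

(* The flag [(i, b, f)] has vertex [i] and facet [f]; its edge joins [i] to
   [i - 1] if [b], and to [i + 1] otherwise. *)
Definition locus := (Zn * bool * (bool * bool))%type.

Definition edge_index (t : locus) : Zn := if t.1.2 then t.1.1 - 1 else t.1.1.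

(** The index [k] is [cell_rank], one more than the rank in the polytope. A locus records no edge
    label, since the facet determines it. *)
Definition face_of (t : locus) (k : nat) : cell :=
  match k with
  | 0 => Bot
  | 1 => Vert t.1.1
  | 2 => Edge (edge_index t) (lam (residue (edge_index t)) t.2)
  | 3 => Facet t.2
  | _ => Top
  end.

Definition flag_of (t : locus) : {set cell} := [set x | x == face_of t (cell_rank x)].

Lemma cell_rank_le4 x : (cell_rank x <= 4)%N. Proof. by case: x. Qed.

Lemma cell_rank_face t k : (k <= 4)%N -> cell_rank (face_of t k) = k.
Proof. by case: k => [|[|[|[|[]]]]]. Qed.

Lemma face_in_flag t k : (k <= 4)%N -> face_of t k \in flag_of t.
Proof. by move=> k4; rewrite inE cell_rank_face. Qed.

Lemma face_of_eq t t' : (forall k, (0 < k < 4)%N -> face_of t k = face_of t' k) -> t = t'.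
Proof.
move: t t' => [[i b] f] [[i' b'] f'] E; have [] := (E 1%N isT, E 2%N isT, E 3%N isT).
case=> -[->] /= + [->]; case; rewrite /edge_index /=.
case: b b' {E} => [] [] //= /eqP; first by rewrite pred_neq.
by rewrite eq_sym pred_neq.
Qed.

Lemma flag_of_inj : injective flag_of.
Proof.
move=> t t' E; apply: face_of_eq => k /andP[_ /ltnW k4].
by have := face_in_flag t k4; rewrite E inE cell_rank_face // => /eqP.
Qed.

Lemma face_of_lt t k : (k < 4)%N -> (face_of t k < face_of t k.+1)%O.
Proof.
move=> k4; rewrite cell_ltE (cell_rank_face t (ltnW k4)) (cell_rank_face t k4) ltnSn andbT.
case: k k4 => [|[|[|[|//]]]] //= _; rewrite ?eqxx // /edge_index.
by case: ifP => _; rewrite ?subrK eqxx ?orbT.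
Qed.

Lemma face_of_le t k l : (k <= l <= 4)%N -> (face_of t k <= face_of t l)%O.
Proof.
case/andP; elim: l => [|l IHl]; first by rewrite leqn0 => /eqP->.
rewrite leq_eqVlt => /orP[/eqP-> // | kl] l4.
exact: le_trans (IHl kl (ltnW l4)) (ltW (face_of_lt t l4)).
Qed.

Lemma card_flag_of t : #|flag_of t| = 5%N.
Proof.
have rk (k : 'I_5) : cell_rank (face_of t k) = k by apply: cell_rank_face; case: k.
have -> : flag_of t = [set face_of t k | k : 'I_5].
  apply/setP=> x; rewrite inE; apply/eqP/imsetP=> [xE | [k _ ->]]; last by rewrite rk.
  by exists (inord (cell_rank x)); rewrite ?inordK ?ltnS ?cell_rank_le4.
rewrite card_imset ?card_ord // => k l /(congr1 cell_rank).
by rewrite !rk; apply: val_inj.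
Qed.

Lemma chain_flag_of t : chain (flag_of t).
Proof.
apply/forall_inP=> x; rewrite inE => /eqP->; apply/forall_inP=> y; rewrite inE => /eqP->.
apply/orP; case/orP: (leq_total (cell_rank x) (cell_rank y)) => xy; [left|right];
  by rewrite face_of_le // xy cell_rank_le4.
Qed.

(** A chain has at most one face of each rank. Missing ones are chosen from the top down: a facet on
    the edge of [C] if there is one, then a place for the edge next to the vertex of [C], then an
    end of that edge. *)
Lemma chain_sub_flag_of (C : {set cell}) : chain C -> exists t, C \subset flag_of t.
Proof.
move=> chC; have C_le x y : x \in C -> y \in C -> (cell_rank x <= cell_rank y)%N -> cell_le x y.
  move=> xC yC xy; case/orP: (forall_inP (forall_inP chC x xC) y yC) => // /cell_le_rank.
  by case/orP=> [/eqP-> | yx]; [exact: cell_le_refl | rewrite ltnNge xy in yx].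
have [f ffP efP] : exists2 f, forall g, Facet g \in C -> g = f &
    forall j s, Edge j s \in C -> lam (residue j) f = s.
  case: (pickP [pred g | Facet g \in C]) => /= [f fC | noF].
    by exists f => [g gC | j s jC]; apply/eqP; [have := C_le _ _ gC fC isT | have := C_le _ _ jC fC isT].
  case: (pickP [pred e | Edge e.1 e.2 \in C]) => /= [[j s] eC | noE].
    exists (solve (residue j) s false) => [g gC | j' s' eC']; first by have := noF g; rewrite /= gC.
    by have /eqP[-> ->] := C_le _ _ eC' eC isT; case: (lam_solve (residue j) s false).
  by exists (false, false) => [g gC | j s jC]; [have := noF g; rewrite /= gC | have := noE (j, s); rewrite /= jC].
have [j ejP vjP] : exists2 j, forall j' s, Edge j' s \in C -> j' = j &
    forall i, Vert i \in C -> i = j \/ i = j + 1.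
  case: (pickP [pred e | Edge e.1 e.2 \in C]) => /= [[j s] eC | noE].
    exists j => [j' s' eC' | i iC]; first by have /eqP[] := C_le _ _ eC' eC isT.
    by case/orP: (C_le _ _ iC eC isT) => /eqP; [left|right].
  have noE' j s : Edge j s \notin C by have /= -> := noE (j, s).
  case: (pickP [pred i | Vert i \in C]) => /= [i iC | noV].
    exists i => [j s eC | i' iC']; first by rewrite (negPf (noE' j s)) in eC.
    by left; have /eqP[] := C_le _ _ iC' iC isT.
  by exists 0 => [j s eC | i iC]; [rewrite (negPf (noE' j s)) in eC | have := noV i; rewrite /= iC].
have [i viP ij] : exists2 i, forall i', Vert i' \in C -> i' = i & i = j \/ i = j + 1.
  case: (pickP [pred i | Vert i \in C]) => /= [i iC | noV].
    by exists i => [i' iC'|]; [have /eqP[] := C_le _ _ iC' iC isT | apply: vjP].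
  by exists j => [i' iC'|]; [have := noV i'; rewrite /= iC' | left].
have [t [tv te tf]] : exists t : locus, [/\ t.1.1 = i, edge_index t = j & t.2 = f].
  case: ij => ->; first by exists (j, false, f).
  by exists (j + 1, true, f); rewrite /edge_index addrK.
exists t; apply/subsetP=> x xC; rewrite inE.
case: x xC => [|i'|j' s|g|] //= xC; rewrite ?tv ?te ?tf.
- by rewrite (viP _ xC).
- by rewrite -(efP _ _ xC) (ejP _ _ xC).
- by rewrite (ffP _ xC).
Qed.

Lemma chain5_flag_of (C : {set cell}) : chain C -> #|C| = 5%N -> exists t, C = flag_of t.
Proof.
move=> /chain_sub_flag_of[t Ct] C5; exists t; apply/eqP.
by rewrite eqEcard Ct card_flag_of C5.
Qed.

Lemma flagsP (C : {set cell}) : reflect (exists t, C = flag_of t) (C \in flags cell).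
Proof.
rewrite inE; apply: (iffP maxsetP) => [[chC maxC] | [t ->]].
  have [t Ct] := chain_sub_flag_of chC; exists t.
  by rewrite (maxC _ (chain_flag_of t)).
split=> [|D chD tD]; first exact: chain_flag_of.
have [t' Dt'] := chain_sub_flag_of chD.
apply/eqP; rewrite eq_sym eqEcard tD card_flag_of.
by rewrite -(card_flag_of t') subset_leq_card.
Qed.

Lemma card_flags : #|flags cell| = (2 * m.+3 * 4)%N.
Proof.
have -> : flags cell = [set flag_of t | t : locus].
  by apply/setP=> C; apply/flagsP/imsetP=> [[t ->] | [t _ ->]]; exists t.
rewrite card_imset; last exact: flag_of_inj.
by rewrite !card_prod card_ord !card_bool; lia.
Qed.

Lemma cell_card_flag C : C \in flags cell -> #|C| = (3 + 2)%N.
Proof. by case/flagsP=> t ->; rewrite card_flag_of. Qed.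

Definition cell_polyhedron : polyhedron :=
  @Polytope 3 _ cell cell_height erefl erefl cell_height_lt cell_card_flag
    cell_connected cell_diamond.

Lemma cell_tight : tight cell_polyhedron m.+3 4.
Proof.
split; last exact: card_flags.
split=> [F hF | v hv].
  case: F hF => [|i|j s|f|] //= _; split=> //; exact: facet_polygon.
case: v hv => [|i|j s|f|] //= _; split=> //; exact: vertex_polygon.
Qed.

(** * Adjacent flags and flag-connectedness *)

Definition move (r : 'I_3) (t : locus) : locus :=
  let: (i, b, f) := t in
  match val r with
  | 0 => if b then (i - 1, false, f) else (i + 1, true, f)
  | 1 => (i, ~~ b, f)
  | _ => (i, b, shift (dir (residue (edge_index t))) f)
  end.

(** This description mentions only equality of faces, so it is symmetric in the two flags and
    invariant under automorphisms; [moveK] and [act_move] follow from it. *)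
Lemma moveP (r : 'I_3) t t' : t' = move r t <->
  t' <> t /\ (forall k, (0 < k < 4)%N -> k != r.+1 -> face_of t' k = face_of t k).
Proof.
split=> [-> | []]; move: t => [[i b] f].
  split.
    case: r => [[|[|[|//]]] ? /=]; [by case: b | by case; case: b |].
    by case=> /eqP; rewrite eq_sym shift_dir_neq.
  case: r => [[|[|[|//]]] ?] [|[|[|[|//]]]] //= _ _; rewrite /edge_index //=.
  - by case: b => //=; rewrite addrK.
  - by case: b.
  - by rewrite lam_shift lam_dir.
move: t' => [[i' b'] f'] tt'.
case: r => [[|[|[|//]]] ?] E /=.
- have [f'f] := E 3%N isT isT; have [] := E 2%N isT isT => {E}.
  rewrite /edge_index /=; move: tt'; rewrite f'f.
  case: b b' => [] [] // tt'.
  + by move/addIr=> i'i; case: tt'; rewrite i'i.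
  + by move=> ->.
  + by move=> <-; rewrite subrK.
  + by move=> i'i; case: tt'; rewrite i'i.
- have [f'f] := E 3%N isT isT; have [i'i] := E 1%N isT isT => {E}.
  by move: tt'; rewrite f'f i'i; case: b b' => [] [].
- have [i'i] := E 1%N isT isT; have := E 2%N isT isT => {E}.
  rewrite /edge_index /= i'i => -[jj] /=.
  have b'b : b' = b by move: jj {tt'}; case: b b' => [] [] //= /eqP; rewrite ?pred_neq // eq_sym pred_neq.
  by rewrite b'b => /lam_eqP[f'f | -> //]; case: tt'; rewrite i'i b'b f'f.
Qed.

Definition base_locus : locus := (0, false, (false, false)).

(** Move 0 followed by move 1 advances the vertex. Move 2 at a vertex of residue [c] translates the
    facet by [dir c], and [dir 0] and [dir 1] span the plane. *)
Lemma locus_ind (Q : locus -> Prop) :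
  Q base_locus -> (forall r t, Q t -> Q (move r t)) -> forall t, Q t.
Proof.
move=> Q0 Qm.
have Q1 i f : Q (i, false, f) -> Q (i + 1, false, f).
  by move=> Qi; apply: (Qm 1 _ (Qm 0 _ Qi)).
have Qn n i f : Q (i, false, f) -> Q (i + n%:R, false, f).
  move=> Qi; elim: n => [|n IHn]; first by rewrite addr0.
  by rewrite -natr1 addrA; apply: Q1.
have Qi i j f : Q (i, false, f) -> Q (j, false, f).
  by move/(Qn (val (j - i))); rewrite natr_Zp addrC subrK.
have Qdir (c : Zn) i f : Q (i, false, f) -> Q (i, false, shift (dir (residue c)) f).
  by move=> Qf; apply: Qi (c) _ _ (Qm (1 + 1) _ (Qi i c f Qf)).
case=> [[i b] f]; have Qf : Q (i, false, f).
  move: (Qdir 0 i) (Qdir 1 i) (Qi 0 i _ Q0) => Qd0 Qd1 Q00.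
  case: f => [[] []] //.
  - by have := Qd1 _ (Qd0 _ Q00); rewrite residue1.
  - by have := Qd1 _ Q00; rewrite residue1.
  - by have := Qd0 _ Q00.
by case: b => //; apply: (Qm 1 _ Qf).
Qed.

(** * Automorphisms *)

Local Notation A := (Aut_poset cell).

Lemma autP (s : {perm cell}) : reflect (forall x y, (s x <= s y)%O = (x <= y)%O) (s \in A).
Proof.
rewrite inE; apply: (iffP forallP) => [sP x y | sP x]; first exact/eqP/(forallP (sP x)).
by apply/forallP=> y; rewrite sP.
Qed.

(** A face of rank [k] tops a chain that climbs from rank 0 inside a flag; its image is a strict
    chain of the same length, so the rank cannot drop. The inverse gives the other inequality. *)
Lemma aut_rank s x : s \in A -> cell_rank (s x) = cell_rank x.
Proof.
have rank_ge u y : u \in A -> (cell_rank y <= cell_rank (u y))%N.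
  move/autP=> uP.
  have [t yt] : exists t, y = face_of t (cell_rank y).
    have [|t] := @chain_sub_flag_of [set y].
      apply/forall_inP=> ? /set1P->; apply/forall_inP=> ? /set1P->; exact: comparablexx.
    by rewrite sub1set inE => /eqP; exists t.
  have: forall k, (k <= 4)%N -> (k <= cell_rank (u (face_of t k)))%N.
    elim=> // k IHk k4; apply: leq_ltn_trans (IHk (ltnW k4)) _.
    have : (u (face_of t k) < u (face_of t k.+1))%O.
      by rewrite lt_neqAle uP (inj_eq perm_inj) -lt_neqAle face_of_lt.
    by rewrite cell_ltE => /andP[].
  by move/(_ _ (cell_rank_le4 y)); rewrite -yt.
move=> sA; apply/eqP; rewrite eqn_leq rank_ge // andbT.
by have := rank_ge _ (s x) (groupVr sA); rewrite permK.
Qed.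

(** The default value [t] is met only when [s] is not an automorphism. *)
Definition act_locus (t : locus) (s : {perm cell}) : locus :=
  odflt t [pick t' | flag_of t' == s @: flag_of t].

Lemma flag_of_act t s : s \in A -> flag_of (act_locus t s) = s @: flag_of t.
Proof.
move=> sA; rewrite /act_locus; case: pickP => [t' /eqP // | no].
have [||t' Et'] := @chain5_flag_of (s @: flag_of t).
- apply/forall_inP=> ? /imsetP[x xt ->]; apply/forall_inP=> ? /imsetP[y yt ->].
  have := forall_inP (forall_inP (chain_flag_of t) x xt) y yt.
  by rewrite /Order.comparable !(autP _ sA).
- by rewrite card_imset ?card_flag_of //; apply: perm_inj.
by have := no t'; rewrite Et' eqxx.
Qed.

Lemma face_of_act t s k : s \in A -> (k <= 4)%N -> face_of (act_locus t s) k = s (face_of t k).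
Proof.
move=> sA k4; have : s (face_of t k) \in flag_of (act_locus t s).
  by rewrite flag_of_act // imset_f // face_in_flag.
by rewrite inE aut_rank // cell_rank_face // => /eqP.
Qed.

Lemma act_locusE t t' s : s \in A ->
  (forall k, (0 < k < 4)%N -> face_of t' k = s (face_of t k)) -> act_locus t s = t'.
Proof.
move=> sA E; apply: face_of_eq => k k4; rewrite E // face_of_act //.
by case/andP: k4 => _ /ltnW.
Qed.

Lemma act_locusM t s u : s \in A -> u \in A -> act_locus t (s * u) = act_locus (act_locus t s) u.
Proof.
move=> sA uA; apply: act_locusE => [|k /andP[_ /ltnW k4]]; first exact: groupM.
by rewrite !face_of_act // permM.
Qed.

Lemma act_locus1 t : act_locus t 1 = t.
Proof. by apply: act_locusE => [|k _]; rewrite ?group1 ?perm1. Qed.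

Lemma act_move r t s : s \in A -> act_locus (move r t) s = move r (act_locus t s).
Proof.
move=> sA; have /moveP[neq_t E] := erefl (move r t).
apply/moveP; split=> [E' | k k4 kr].
  apply: neq_t; apply: face_of_eq => k k4.
  apply: (@perm_inj _ s); rewrite -!face_of_act ?E' //; by case/andP: k4 => _ /ltnW.
by rewrite !face_of_act ?E //; case/andP: k4 => _ /ltnW.
Qed.

Lemma moveK r : involutive (move r).
Proof.
move=> t; have /moveP[neq_t E] := erefl (move r t); apply/esym/moveP.
by split=> [|k k4 kr]; [apply/nesym | rewrite E].
Qed.

(** Moves are involutions, so a path from the base flag to [t0] can be run backwards. *)
Lemma locus_connected (Q : locus -> Prop) t0 :
  Q t0 -> (forall r t, Q t -> Q (move r t)) -> forall t, Q t.
Proof.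
move=> Qt0 Qm; have: Q t0 -> Q base_locus.
  by elim/locus_ind: t0 {Qt0} => // r t IHt /(Qm r); rewrite moveK.
by move=> /(_ Qt0) Qb t; elim/locus_ind: t.
Qed.

Lemma act_free t s : s \in A -> act_locus t s = t -> s = 1%g.
Proof.
move=> sA ts; have {ts} fix_s : forall t', act_locus t' s = t'.
  by apply: (locus_connected ts) => r t' IHt'; rewrite act_move ?IHt'.
apply/permP=> x; rewrite perm1.
have [t' xt'] : exists t', x \in flag_of t'.
  have [|t'] := @chain_sub_flag_of [set x]; last by rewrite sub1set; exists t'.
  by apply/forall_inP=> ? /set1P->; apply/forall_inP=> ? /set1P->; exact: comparablexx.
move: xt'; rewrite inE => /eqP ->.
by rewrite -face_of_act ?fix_s ?cell_rank_le4.
Qed.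

(** The link between the adjacency of the definition of reflections and [move]; the shift by one
    between the two ranks is absorbed here. *)
Lemma adjacentP (r : 'I_3) t t' :
  @adjacent_flags 3 cell_polyhedron (Posz r) (flag_of t) (flag_of t') <-> t' = move r t.
Proof.
have heightE x : (cell_height x != Posz r) = (cell_rank x != r.+1).
  by rewrite /cell_height; lia.
rewrite /adjacent_flags /= (inj_eq flag_of_inj); split.
  case/andP=> tt' /eqP E; apply/moveP; split=> [tt'E | k k4 kr].
    by rewrite tt'E eqxx in tt'.
  have k4' : (k <= 4)%N by case/andP: k4 => _ /ltnW.
  have: face_of t' k \in [set x in flag_of t' | cell_height x != Posz r].
    by rewrite inE face_in_flag // heightE cell_rank_face.
  by rewrite -E !inE cell_rank_face // => /andP[/eqP].
case/moveP=> tt' E; apply/andP; split; first by apply/eqP=> t't; case: tt'.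
apply/eqP/setP=> x; rewrite !inE heightE [LHS]andbC [RHS]andbC; apply: andb_id2l => xr.
have [k4|] := boolP (0 < cell_rank x < 4)%N; first by rewrite E.
by case: x {xr}.
Qed.

(** * Explicit automorphisms: reflections of the cycle and translations of the plane *)

Lemma cell_le_hom_aut (h : cell -> cell) (hK : involutive h) :
  (forall x y, cell_le x y -> cell_le (h x) (h y)) -> perm (can_inj hK) \in A.
Proof.
move=> h_homo; apply/autP=> x y; rewrite !permE; apply/idP/idP; last exact: h_homo.
by move/h_homo; rewrite !hK.
Qed.

(** The edges from [j] to [j + 1] go to those from [a - 1 - j] to [a - j]; [mirror] permutes the
    forms accordingly, so labels are kept. *)
Definition reflect_cell (a : Zn) (x : cell) : cell :=
  match x with
  | Vert i => Vert (a - i)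
  | Edge j s => Edge (a - 1 - j) s
  | Facet f => Facet (mirror (residue a) f)
  | _ => x
  end.

Definition shift_cell (w : bool * bool) (x : cell) : cell :=
  match x with
  | Edge j s => Edge j (lam (residue j) w (+) s)
  | Facet f => Facet (shift w f)
  | _ => x
  end.

Lemma reflect_cellK a : involutive (reflect_cell a).
Proof. by case=> [|i|j s|f|] //=; rewrite ?subKr ?mirrorK. Qed.

Lemma shift_cellK w : involutive (shift_cell w).
Proof. by case=> [|i|j s|f|] //=; rewrite ?addKb ?shiftK. Qed.

Lemma reflect_cell_le a x y : cell_le x y -> cell_le (reflect_cell a x) (reflect_cell a y).
Proof.
case: x y => [|i|j s|f|] [|i'|j' s'|f'|] //=; rewrite ?ltnn //= ?cell_eqE.
- by move/eqP->.
- have -> : a - 1 - j' + 1 = a - j' by rewrite addrAC subrK.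
  by case/orP=> /eqP->; rewrite ?eqxx ?orbT // opprD addrA addrAC eqxx.
- by case/andP=> /eqP-> /eqP->; rewrite !eqxx.
- by rewrite !residueB residue1 lam_mirror.
- by move/eqP->.
Qed.

Lemma shift_cell_le w x y : cell_le x y -> cell_le (shift_cell w x) (shift_cell w y).
Proof.
case: x y => [|i|j s|f|] [|i'|j' s'|f'|] //=; rewrite ?ltnn //= ?cell_eqE.
- by case/andP=> /eqP-> /eqP->; rewrite !eqxx.
- by rewrite lam_shift => /eqP->.
- by move/eqP->.
Qed.

(** With [a = 1] the ends 0 and 1 of the base edge are exchanged; with [a = 0] vertex 0 is fixed and
    the places 0 and -1 are exchanged. Both fix the origin of the plane, the base facet. Translation
    by [dir 0] keeps the base edge, as [dir 0] is in the kernel of its form. *)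
Definition generator (r : 'I_3) : {perm cell} :=
  match val r with
  | 0 => perm (can_inj (reflect_cellK 1))
  | 1 => perm (can_inj (reflect_cellK 0))
  | _ => perm (can_inj (shift_cellK (dir 0)))
  end.

Lemma generator_aut r : generator r \in A.
Proof.
rewrite /generator; case: (val r) => [|[|_]]; apply: cell_le_hom_aut;
  by [exact: reflect_cell_le | exact: shift_cell_le].
Qed.

Lemma residue0 : residue 0 = 0.
Proof. exact: val_inj. Qed.

Lemma lam0 c : lam c (false, false) = false.
Proof. by move: c; apply: I3P. Qed.

Lemma act_generator r : act_locus base_locus (generator r) = move r base_locus.
Proof.
apply: act_locusE; first exact: generator_aut.
case: r => [[|[|[|//]]] ?] [|[|[|[|//]]]] //= _; rewrite /generator permE /= /edge_index /=;
  by rewrite ?(add0r, subrr, subr0, sub0r, oppr0, residue0, lam0).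
Qed.

End Cell.

(** * The normal form in Lambda(k) *)

Section Klein.
Local Open Scope group_scope.
Context {G : groupType} (r0 r1 r2 : G).
Context (r0K : r0 * r0 = 1) (r1K : r1 * r1 = 1) (r2K : r2 * r2 = 1).
Context (r02K : r0 * r2 * (r0 * r2) = 1) (r12K : (r1 * r2) ^+ 4 = 1).
Context (r_odd : r0 * r1 * r2 * r1 * r0 * r1 * r2 * r1 * r2 = 1).

Local Notation b := (r2 ^ r1).
Local Notation c := (b ^ r0).

(** The values are arranged so that conjugation by [r1 * r0] takes the image of [dir d] to that of
    [dir (d + 1)]. *)
Definition klein (f : bool * bool) : G :=
  match f with
  | (false, false) => 1
  | (false, true) => r2
  | (true, true) => b
  | (true, false) => c
  end.

Lemma invol_inv (x : G) : x * x = 1 -> x^-1 = x.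
Proof. by move=> xK; rewrite -[LHS]mulg1 -xK mulgA mulVg mul1g. Qed.

Lemma klein_r2_r0 : r2 ^ r0 = r2.
Proof.
by rewrite conjgE (invol_inv r0K) -{2}[r2]mul1g -r02K -!mulgA r2K mulg1.
Qed.

Lemma klein_bK : b * b = 1.
Proof. by rewrite -conjMg r2K conj1g. Qed.

(** The square of [r2 * b] is conjugate to the fourth power of [r1 * r2], hence trivial, and
    involutions with an involutive product commute. *)
Lemma klein_comm : r2 * b = b * r2.
Proof.
rewrite -[LHS](invol_inv (_ : _ * _ = 1)).
  by rewrite invMg (invol_inv r2K) (invol_inv klein_bK).
have : (r2 * b) ^+ 2 = ((r1 * r2) ^+ 4) ^ r1.
  by rewrite !conjgE (invol_inv r1K) expgS expg1 !expgS expg0 !mulgA r1K !mul1g mulg1.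
by rewrite r12K conj1g => <-.
Qed.

(** The relator of odd length is the product of [c], [b] and [r2], in this order. *)
Lemma klein_c : c = r2 * b.
Proof.
rewrite klein_comm -[RHS](invol_inv (_ : _ * _ = 1)); last first.
  by rewrite -{1}klein_comm -(mulgA r2 b) (mulgA b b) klein_bK mul1g r2K.
apply: (mulIg (b * r2)); rewrite [RHS]mulVg !mulgA -r_odd.
by rewrite !conjgE (invol_inv r0K) (invol_inv r1K) !mulgA.
Qed.

Lemma kleinM f g : klein (shift f g) = klein f * klein g.
Proof.
have ac : r2 * c = b by rewrite klein_c mulgA r2K mul1g.
have bc : b * c = r2 by rewrite klein_c klein_comm mulgA klein_bK mul1g.
have cK : c * c = 1 by rewrite -conjMg klein_bK conj1g.
have ca : c * r2 = b by rewrite klein_c klein_comm -mulgA r2K mulg1.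
have cb : c * b = r2 by rewrite klein_c -mulgA klein_bK mulg1.
by case: f g => [[] []] [[] []]; rewrite /shift /= ?mulg1 ?mul1g ?cK ?klein_bK ?r2K ?ac ?bc ?ca ?cb
  -?klein_c -?klein_comm -?klein_c.
Qed.

Lemma klein_dir_rot d : klein (dir d) ^ (r1 * r0) = klein (dir (d + 1)%R).
Proof.
have br1 : b ^ r1 = r2 by rewrite -conjgM r1K conjg1.
have cr1 : c ^ r1 = c by rewrite klein_c conjMg br1 klein_comm.
move: d; apply: I3P; rewrite conjgM //=.
  by rewrite cr1 -conjgM r0K conjg1.
by rewrite br1 klein_r2_r0.
Qed.

Lemma klein_dir_pow d n :
  klein (dir d) * (r1 * r0) ^+ n = (r1 * r0) ^+ n * klein (dir (d + n%:R)%R).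
Proof.
elim: n => [|n IHn]; first by rewrite addr0 mulg1 mul1g.
by rewrite expgSr mulgA IHn -mulgA (conjgC (klein _)) klein_dir_rot mulgA -addrA natr1.
Qed.

End Klein.

(** * Words as classes in [Lambda k] and as walks on flags *)

Section LambdaIso.
Local Open Scope group_scope.
Context {m k : nat} (mk : (3 * k = m.+3)%N).
Local Notation L := (Lambda k).
Local Notation locus := (locus m).

Definition rho (i : 'I_3) : L := word_class (Lambda_relators k) [:: (i, false)].
Local Arguments rho i%_R.

Lemma word_class_cat (R : seq (word 'I_3)) u v :
  word_class R (u ++ v) = word_class R u * word_class R v :> presented R.
Proof. by rewrite -word_class_mul. Qed.

Lemma word_class_relator r : r \in Lambda_relators k -> word_class (Lambda_relators k) r = 1.
Proof.
move=> rR; apply/word_classP; rewrite -[r]cats0.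
exact: (presents_relator [::] [::] rR).
Qed.

Lemma word_class_exp w n :
  word_class (Lambda_relators k) (word_exp w n) = (word_class (Lambda_relators k) w : L) ^+ n.
Proof.
elim: n => // n IHn; by rewrite expgS -IHn -word_class_cat.
Qed.

Lemma Lambda_relatorsE : Lambda_relators k =
  [:: [:: (0%R, false); (0%R, false)]; [:: (1%R, false); (1%R, false)];
      [:: (2%R, false); (2%R, false)];
      word_exp [:: (0%R, false); (1%R, false)] (3 * k);
      [:: (0%R, false); (2%R, false); (0%R, false); (2%R, false)];
      word_exp [:: (1%R, false); (2%R, false)] 4;
      [:: (0%R, false); (1%R, false); (2%R, false); (1%R, false); (0%R, false);
          (1%R, false); (2%R, false); (1%R, false); (2%R, false)]].
Proof.
rewrite /Lambda_relators.
have -> : Ordinal (isT : 0 < 3)%N = 0%R by apply: val_inj.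
have -> : Ordinal (isT : 1 < 3)%N = 1%R by apply: val_inj.
by have -> : Ordinal (isT : 2 < 3)%N = 2%R by apply: val_inj.
Qed.

Lemma rho_square i : word_class (Lambda_relators k) [:: (i, false); (i, false)] = 1.
Proof.
apply: word_class_relator; rewrite Lambda_relatorsE.
by move: i; apply: I3P; rewrite !inE eqxx ?orbT.
Qed.

(** Generators are involutions, so the exponent sign of a letter is irrelevant; [walk] and
    [word_perm] ignore it too. *)
Lemma word_class_cons (a : 'I_3 * bool) w :
  word_class (Lambda_relators k) (a :: w) = rho a.1 * word_class (Lambda_relators k) w.
Proof.
rewrite -cat1s word_class_cat; congr (_ * _).
case: a => i [] //; apply: (mulgI (rho i)); rewrite -!word_class_cat rho_square.
by apply/word_classP; apply: (presents_cancel _ [::] (i, false) [::]).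
Qed.

Lemma word_class_nil : word_class (Lambda_relators k) [::] = 1 :> L.
Proof. by []. Qed.

Definition word_classE := (word_class_cons, word_class_nil, @mulg1 L).

Lemma rhoK i : rho i * rho i = 1.
Proof. by rewrite -(rho_square i) !word_classE. Qed.

Lemma rho02 : rho 0 * rho 2 * (rho 0 * rho 2) = 1.
Proof.
rewrite -(@word_class_relator [:: (0%R, false); (2%R, false); (0%R, false); (2%R, false)]).
  by rewrite !word_classE !mulgA.
by rewrite Lambda_relatorsE !inE eqxx ?orbT.
Qed.

Lemma rho12 : (rho 1 * rho 2) ^+ 4 = 1.
Proof.
rewrite -(@word_class_relator (word_exp [:: (1%R, false); (2%R, false)] 4)).
  by rewrite word_class_exp !word_classE.
by rewrite Lambda_relatorsE !inE eqxx ?orbT.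
Qed.

Lemma rho01 : (rho 0 * rho 1) ^+ m.+3 = 1.
Proof.
rewrite -(@word_class_relator (word_exp [:: (0%R, false); (1%R, false)] (3 * k))).
  by rewrite word_class_exp !word_classE mk.
by rewrite Lambda_relatorsE !inE eqxx ?orbT.
Qed.

Lemma rho10 : (rho 1 * rho 0) ^+ m.+3 = 1.
Proof.
have -> : rho 1 * rho 0 = (rho 0 * rho 1)^-1.
  by rewrite invgM !(invol_inv (rhoK _)).
by rewrite expVgn rho01 invg1.
Qed.

Lemma rho_odd :
  rho 0 * rho 1 * rho 2 * rho 1 * rho 0 * rho 1 * rho 2 * rho 1 * rho 2 = 1.
Proof.
rewrite -(@word_class_relator [:: (0%R, false); (1%R, false); (2%R, false); (1%R, false);
  (0%R, false); (1%R, false); (2%R, false); (1%R, false); (2%R, false)]).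
  by rewrite !word_classE !mulgA.
by rewrite Lambda_relatorsE !inE eqxx ?orbT.
Qed.

Local Notation u := (klein (rho 0) (rho 1) (rho 2)).

Definition locus_class (t : locus) : L :=
  let: (i, b, f) := t in rho 1 ^+ b * (rho 1 * rho 0) ^+ i * u f.

(** At the wrap-around [i + 1 = 0] this uses that the rotation has order dividing n. *)
Lemma rot_succ (i : 'I_m.+3) :
  (rho 1 * rho 0) ^+ (i + 1)%R = (rho 1 * rho 0) * (rho 1 * rho 0) ^+ i.
Proof.
rewrite -expgS /= (modn_small (isT : (1 < m.+3)%N)) addn1.
have [lt|] := ltnP i.+1 m.+3; first by rewrite modn_small.
rewrite leq_eqVlt ltnNge -ltnS ltnS ltn_ord orbF => /eqP<-.
by rewrite modnn rho10.
Qed.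

Lemma locus_class_move (m3 : (3 %| m.+3)%N) r t :
  locus_class (move r t) = rho r * locus_class t.
Proof.
have m0 i f : locus_class (i + 1, true, f)%R = rho 0 * locus_class (i, false, f).
  by rewrite /locus_class expg1 expg0 mul1g rot_succ !mulgA rhoK mul1g.
case: t => [[i b] f]; move: r; apply: I3P.
- case: b; last exact: m0 i f.
  have /(congr1 (mulg (rho 0))) := m0 (i - 1)%R f.
  by rewrite subrK [RHS]mulgA rhoK mul1g => /esym.
- by case: b; rewrite /locus_class /= expg1 expg0 !mulgA ?rhoK ?mulg1 ?mul1g.
- have comm n : rho 2 * (rho 1 * rho 0) ^+ n = (rho 1 * rho 0) ^+ n * u (dir n%:R).
    have := klein_dir_pow (rhoK 0) (rhoK 1%R) (rhoK 2) rho02 rho12 rho_odd 0 n.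
    by rewrite add0r.
  have uM g : u (shift g f) = u g * u f.
    exact: (kleinM (rhoK 0) (rhoK 1%R) (rhoK 2) rho12 rho_odd).
  have residue_nat : residue i = (val i)%:R%R by rewrite Zp_nat.
  have -> : move (1 + 1)%R (i, b, f) = (i, b, shift (dir (residue (edge_index (i, b, f)))) f).
    by [].
  rewrite -[rho (1 + 1)]/(rho 2) /locus_class uM /edge_index !mulgA; congr (_ * _).
  case: b; rewrite /= ?expg0 ?expg1 ?mul1g; last by rewrite mulg1 comm -residue_nat.
  (* Passing [rho 2] through [rho 1] turns it into the element attached to [dir (0 - 1)]; passing
     through the rotation then gives [dir (i - 1)], as the edge at place [i - 1] requires. *)
  rewrite [rho 2 * _]conjgC -[LHS]mulgA -[RHS]mulgA; congr (_ * _).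
  rewrite residueB // residue1 residue_nat addrC -(sub0r 1%R).
  exact: (esym (klein_dir_pow (rhoK 0) (rhoK 1%R) (rhoK 2) rho02 rho12 rho_odd (0 - 1)%R i)).
Qed.

(** The last letter moves first, to match left multiplication in [locus_class_move]. *)
Definition walk (t : locus) (w : word 'I_3) : locus := foldr (fun a => move a.1) t w.

Lemma word_class_walk (m3 : (3 %| m.+3)%N) w :
  word_class (Lambda_relators k) w = locus_class (walk (base_locus m) w).
Proof.
elim: w => [|a w IHw]; first by rewrite /locus_class /= mulg1 mul1g.
by rewrite word_class_cons IHw -locus_class_move.
Qed.

Lemma walk_surj t0 t : exists w, walk t0 w = t.
Proof.
move: t; apply: (@locus_connected m (fun t => exists w, walk t0 w = t) t0) => [|r t [w <-]]; first by exists [::].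
by exists ((r, false) :: w).
Qed.

Lemma walk_cat t v w : walk t (v ++ w) = walk (walk t w) v.
Proof. exact: foldr_cat. Qed.

Lemma walk_exp t w n : walk t (word_exp w n) = iter n (fun t => walk t w) t.
Proof. by elim: n => // n IHn; rewrite iterS -IHn -walk_cat -[in RHS]/(word_exp w n.+1). Qed.

Local Notation A := (Aut_poset (cell m)).

Lemma walk_act t s w : s \in A -> act_locus (walk t w) s = walk (act_locus t s) w.
Proof. by move=> sA; elim: w => //= a w IHw; rewrite act_move ?IHw. Qed.

Lemma walk_relator (m3 : (3 %| m.+3)%N) w : w \in Lambda_relators k ->
  walk (base_locus m) w = base_locus m.
Proof.
rewrite Lambda_relatorsE !inE.
have resN1 : residue (-1 : 'I_m.+3)%R = (0 - 1)%R by rewrite -sub0r residueB // residue0 residue1.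
do !case/orP; move=> /eqP->.
4: {
  (* Move 1 followed by move 0 takes the vertex one step back, and [m.+3] such steps go once round
     the cycle. *)
  have iterE n : walk (base_locus m) (word_exp [:: (0%R, false); (1%R, false)] n)
      = (- n%:R, false, (false, false))%R.
    elim: n => [|n IHn]; first by rewrite /= oppr0.
    by rewrite walk_exp iterS -walk_exp IHn /= -natr1 opprD.
  rewrite iterE mk; congr (_, _, _); rewrite Zp_nat -[RHS]oppr0; congr (- _)%R.
  by apply: val_inj; rewrite /= modnn.
}
1-3: exact: moveK.
all: by rewrite /walk /= /edge_index /= ?(add0r, subrr, residue0, residue1, resN1).
Qed.

(** * Automorphisms as words in the reflections at an arbitrary flag *)

Section Frame.
Context (t0 : locus) (r : 'I_3 -> {perm cell m}).
Context (rA : forall i, r i \in A) (act_r : forall i, act_locus t0 (r i) = move i t0).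

Definition word_perm (w : word 'I_3) : {perm cell m} := foldr (fun a s => r a.1 * s) 1 w.

Lemma word_perm_aut w : word_perm w \in A.
Proof. by elim: w => [|a w IHw] /=; [apply: group1 | apply: groupM]. Qed.

(** Automorphisms commute with moves, so the first factor, which acts first, contributes the
    outermost move. *)
Lemma act_word_perm w : act_locus t0 (word_perm w) = walk t0 w.
Proof.
elim: w => [|a w IHw] /=; first exact: act_locus1.
by rewrite act_locusM ?word_perm_aut // act_r act_move ?word_perm_aut // IHw.
Qed.

(** Some walk from [t0] ends at its image under [s]; the word of that walk agrees with [s] on [t0],
    and the action is free. *)
Lemma word_perm_surj s : s \in A -> exists w, s = word_perm w.
Proof.
move=> sA; have [w tw] := walk_surj t0 (act_locus t0 s); exists w.
apply/eqP; rewrite eq_mulgV1; apply/eqP/(@act_free _ t0).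
  by rewrite groupM ?groupV ?word_perm_aut.
rewrite act_locusM ?groupV ?word_perm_aut // -tw -act_word_perm -act_locusM ?groupV ?word_perm_aut //.
by rewrite mulgV act_locus1.
Qed.

Lemma word_perm_eq1 w : walk t0 w = t0 -> word_perm w = 1.
Proof. by move=> tw; apply: (@act_free _ t0); rewrite ?word_perm_aut // act_word_perm. Qed.

End Frame.

(** * Regularity, the isomorphism with [Lambda k], and non-orientability *)

Section Base.
Context (m3 : (3 %| m.+3)%N).

Local Notation P := (cell_polyhedron m3).

Let base_perm := word_perm (@generator m).
Let base_perm_aut : forall w, base_perm w \in A := word_perm_aut (@generator_aut m m3).
Let act_base_perm : forall w, act_locus (base_locus m) (base_perm w) = walk (base_locus m) w :=
  act_word_perm (@generator_aut m m3) (@act_generator m m3).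

Lemma cell_regular : regular P.
Proof.
apply/imsetP; exists (flag_of (base_locus m)).
  by apply/flagsP; exists (base_locus m).
apply/setP=> C; apply/flagsP/imsetP => [[t ->] | [s sA ->]].
  have [w tw] := walk_surj (base_locus m) t; exists (base_perm w); first exact: base_perm_aut.
  by rewrite /= /setact -tw -act_base_perm flag_of_act.
by exists (act_locus (base_locus m) s); rewrite flag_of_act.
Qed.

Lemma base_perm_cat u v : base_perm (u ++ v) = base_perm u * base_perm v.
Proof. by elim: u => [|a u IHu] /=; rewrite ?mul1g // -mulgA -IHu. Qed.

(** By freeness a relator acts trivially as soon as its walk closes up at the base flag. *)
Lemma base_perm_presents u v : presents_eq (Lambda_relators k) u v -> base_perm u = base_perm v.
Proof.
elim=> // [u' v' w' _ -> _ -> // | u' a v' | u' r v' rR].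
  rewrite !base_perm_cat; congr (_ * _); rewrite -[RHS]mul1g; congr (_ * _).
  apply: (word_perm_eq1 (@generator_aut m m3) (@act_generator m m3)).
  exact: moveK.
rewrite !base_perm_cat; congr (_ * _); rewrite -[RHS]mul1g; congr (_ * _).
by apply: (word_perm_eq1 (@generator_aut m m3) (@act_generator m m3)); apply: walk_relator.
Qed.

Definition aut_class (s : [subg A]) : L := locus_class (act_locus (base_locus m) (val s)).

Lemma aut_class_perm (s : [subg A]) w : val s = base_perm w -> aut_class s = word_class _ w.
Proof. by rewrite /aut_class => ->; rewrite act_base_perm word_class_walk. Qed.

Lemma aut_classM : {morph aut_class : s t / s * t >-> s * t}.
Proof.
move=> s t; have [u su] := word_perm_surj (@generator_aut m m3) (@act_generator m m3) (valP s).
have [v tv] := word_perm_surj (@generator_aut m m3) (@act_generator m m3) (valP t).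
rewrite (aut_class_perm su) (aut_class_perm tv) -word_class_cat.
by apply: aut_class_perm; rewrite base_perm_cat -[base_perm u]su -[base_perm v]tv.
Qed.

HB.instance Definition _ := isMultiplicative.Build [subg A]%type L aut_class aut_classM.

Definition class_aut (x : L) : [subg A] := Sub (base_perm (generic_quotient.repr x)) (base_perm_aut _).

Lemma class_autK : cancel class_aut aut_class.
Proof.
by move=> x; rewrite (@aut_class_perm _ (generic_quotient.repr x)) ?word_classK.
Qed.

Lemma aut_classK : cancel aut_class class_aut.
Proof.
move=> s; apply: val_inj; rewrite /=.
have [w sw] := word_perm_surj (@generator_aut m m3) (@act_generator m m3) (valP s).
rewrite (aut_class_perm sw) [RHS]sw; apply: base_perm_presents.
exact: presents_repr.
Qed.

Lemma aut_isomorphic : isomorphic [subg Aut_poset P]%type L.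
Proof. by exists aut_class; exists class_aut; [exact: aut_classK | exact: class_autK]. Qed.

(* The relator of odd length writes [r 2], hence every [r i], as a product of
   rotations. *)
Lemma rotations_generate t0 (r : 'I_3 -> {perm cell m}) :
    (forall i, r i \in A) -> (forall i, act_locus t0 (r i) = move i t0) ->
  <<[set r 0%R * r 1%R; r 1%R * r 2%R]>> = A.
Proof.
move=> rA act_r; set H := <<_>>.
have r01 : r 0%R * r 1%R \in H by rewrite mem_gen // set21.
have r12 : r 1%R * r 2%R \in H by rewrite mem_gen // set22.
have rV i : (r i)^-1 = r i.
  apply: invol_inv; have := word_perm_eq1 rA act_r (moveK i t0 : walk t0 [:: (i, false); (i, false)] = t0).
  by rewrite /= mulg1.
have r21 : r 2%R * r 1%R \in H by have := groupVr r12; rewrite invMg !rV.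
have r2H : r 2%R \in H.
  have [w tw] := walk_surj (base_locus m) t0.
  (* An automorphism carries the base flag to [t0], and walks commute with it, so the relator closes
     up at [t0] as well. *)
  have rel : walk t0 [:: (0, false); (1, false); (2, false); (1, false); (0, false);
      (1, false); (2, false); (1, false); (2, false)]%R = t0.
    by rewrite -tw -act_base_perm -walk_act // walk_relator // Lambda_relatorsE !inE eqxx ?orbT.
  have {rel} := word_perm_eq1 rA act_r rel; rewrite /= mulg1.
  rewrite (_ : r 0%R * _ = (r 0%R * r 1%R) * (r 2%R * r 1%R) * (r 0%R * r 1%R) *
    (r 2%R * r 1%R) * r 2%R); last by rewrite !mulgA.
  move=> rel; have : 1 \in H by apply: group1.
  by rewrite -rel (groupMl _ (groupM (groupM (groupM r01 r21) r01) r21)).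
have r1H : r 1%R \in H by rewrite -(groupMr _ r2H).
have r0H : r 0%R \in H by rewrite -(groupMr _ r1H).
apply/eqP; rewrite eqEsubset gen_subG; apply/andP; split.
  by apply/subsetP=> s /set2P[] ->; rewrite groupM.
apply/subsetP=> s /(word_perm_surj rA act_r)[w ->].
elim: w => [|[i b] w IHw] /=; first exact: group1.
by rewrite groupM //; move: i {IHw}; apply: I3P.
Qed.

(** Orientability leaves the base flag and its reflections free, so the rotations are shown to
    generate the whole group for any choice; their index is then 1. *)
Lemma cell_nonorientable : ~ orientably_regular P.
Proof.
case=> _ [C [r0 [r1 [r2 [/flagsP[t0 Ct] [r0A r0t] [r1A r1t] [r2A r2t]]]]]].
pose r (i : 'I_3) : {perm cell m} := match val i with 0 => r0 | 1 => r1 | _ => r2 end.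
have rA i : r i \in A by rewrite /r; case: (val i) => [|[|_]].
have act_r i : act_locus t0 (r i) = move i t0.
  apply/(@adjacentP _ m3); rewrite flag_of_act //.
  by move: r0t r1t r2t; rewrite Ct => r0t r1t r2t; case: i => [[|[|[|//]]] ?].
have HA := rotations_generate rA act_r.
suff: #|A : <<[set r 0%R * r 1%R; r 1%R * r 2%R]>>| = 1%N by move=> /= ->.
by rewrite HA indexgg.
Qed.

End Base.

End LambdaIso.

Theorem theorem5p1 (k : nat) (k_odd : odd k) :
  exists P : polyhedron,
    [/\ tight P (3 * k) 4, regular P, ~ orientably_regular P &
        isomorphic [subg Aut_poset P] (Lambda k)].
Proof.
(* An odd [k] is positive, so the subtraction in [3 * k - 3] is not truncated. *)
have [m mk] : exists m, (3 * k)%N = m.+3.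
  by exists (3 * k - 3)%N; case: k k_odd => // k _; lia.
have m3 : (3 %| m.+3)%N by rewrite -mk dvdn_mulr.
exists (cell_polyhedron m3); split.
- by rewrite mk; apply: cell_tight.
- exact: cell_regular.
- exact: (cell_nonorientable mk).
- exact: (aut_isomorphic mk).
Qed.
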